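(* Let $\mathcal{K}^{\langle\infty\rangle}$ be a planar unbounded simple nested fractal generated by $N$ similitudes with $k\ge3$ essential fixed points, and assume that there are no inessential fixed points, i.e. $k=N$. Then $\mathcal{K}^{\langle\infty\rangle}$ has the good labelling property.
   Context: Setting: $L>1$, $N\ge2$, $\nu_1=0,\dots,\nu_N\in\mathbb{R}^2$, $\Psi_i(x)=x/L+\nu_i$, and $\mathcal{K}^{\langle 0\rangle}=\bigcup_i\Psi_i(\mathcal{K}^{\langle 0\rangle})$ is a planar simple nested fractal (essential fixed points $V_0^{\langle0\rangle}$: fixed points $x$ for which there are another fixed point $y$ and $\Psi_i\ne\Psi_j$ with $\Psi_i(x)=\Psi_j(y)$; open set condition, nesting, symmetry with respect to perpendicular bisectors of pairs of essential fixed points, connectivity); $k=\#V_0^{\langle0\rangle}$, and $V_0^{\langle0\rangle}$ spans a regular $k$-gon. $\mathcal{K}^{\langle M\rangle}=L^M\mathcal{K}^{\langle 0\rangle}$, $\mathcal{K}^{\langle\infty\rangle}=\bigcup_{M\ge0}\mathcal{K}^{\langle M\rangle}$. An $M$-complex is $\Delta_M=\mathcal{K}^{\langle M\rangle}+\nu_{\Delta_M}$ with $\nu_{\Delta_M}=\sum_{j=M+1}^{J}L^j\nu_{i_j}$ ($J\ge M+1$), vertex set $V(\Delta_M)=L^MV_0^{\langle0\rangle}+\nu_{\Delta_M}$; $V_M^{\langle M\rangle}=L^MV_0^{\langle0\rangle}$ and $V_M^{\langle\infty\rangle}$ is the union of all $V(\Delta_M)$. With $\mathcal{A}$ an alphabet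 of $k$ symbols and $\mathcal{R}_M$ the $k$ rotations about the barycenter of $\mathcal{K}^{\langle M\rangle}$ preserving $V_M^{\langle M\rangle}$, a good labelling function of order $M$ is $\ell_M:V_M^{\langle\infty\rangle}\to\mathcal{A}$, bijective on $V_M^{\langle M\rangle}$, such that for each $M$-complex $\Delta_M=\mathcal{K}^{\langle M\rangle}+\nu_{\Delta_M}$ there is $R_{\Delta_M}\in\mathcal{R}_M$ with $\ell_M(v)=\ell_M(R_{\Delta_M}(v-\nu_{\Delta_M}))$, $v\in V(\Delta_M)$. The good labelling property means that a good labelling function of some order $M\in\mathbb{Z}$ exists. *)

(* Defs.v *)
From Stdlib Require Import Relations.
From HB Require Import structures.
From mathcomp Require Import all_boot all_order all_algebra.
From mathcomp Require Import all_classical all_reals all_analysis.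
Set Implicit Arguments. Unset Strict Implicit. Unset Printing Implicit Defensive.
Import Order.TTheory GRing.Theory Num.Theory numFieldNormedType.Exports.
Local Open Scope classical_set_scope.
Local Open Scope ring_scope.

Section Plane.
Variable R : realType.
Local Notation pt := (R * R)%type.

Definition padd (x y : pt) : pt := (x.1 + y.1, x.2 + y.2).
Definition psub (x y : pt) : pt := (x.1 - y.1, x.2 - y.2).
Definition pscale (a : R) (x : pt) : pt := (a * x.1, a * x.2).
Definition pdot (x y : pt) : R := x.1 * y.1 + x.2 * y.2.

Definition Psi (L : R) N (nu : 'I_N -> pt) (i : 'I_N) (x : pt) : pt :=
  padd (pscale L^-1 x) (nu i).

Definition PsiW (L : R) N (nu : 'I_N -> pt) (w : seq 'I_N) (x : pt) : pt :=
  foldr (fun i y => Psi L nu i y) x w.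

Definition essential_fixed_points (L : R) N (nu : 'I_N -> pt) : set pt :=
  [set x | (exists i, Psi L nu i x = x) /\
     exists y, (exists j, Psi L nu j y = y) /\ y <> x /\
       exists i j, Psi L nu i <> Psi L nu j /\ Psi L nu i x = Psi L nu j y].

Definition Vn (L : R) N (nu : 'I_N -> pt) (V0 : set pt) (n : nat) : set pt :=
  [set z | exists w : seq 'I_N, size w = n /\ exists2 v, V0 v & z = PsiW L nu w v].

Definition reflect_bisector (x y z : pt) : pt :=
  let u := psub y x in
  let m := pscale (2^-1) (padd x y) in
  psub z (pscale (2 * pdot (psub z m) u / pdot u u) u).

Definition rotation_about (c : pt) (a b : R) (z : pt) : pt :=
  let d := psub z c in padd c (a * d.1 - b * d.2, b * d.1 + a * d.2).

Definition regular_polygon (V : set pt) (k : nat) : Prop :=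
  exists (c : pt) (r t0 : R), 0 < r /\
    V = [set z | exists j : 'I_k,
           z = padd c (r * cos (t0 + 2 * pi * j%:R / k%:R),
                       r * sin (t0 + 2 * pi * j%:R / k%:R))].

Definition simple_nested_fractal (L : R) N (nu : 'I_N -> pt)
    (K V0 : set pt) (k : nat) (v : 'I_k -> pt) : Prop :=
  [/\ [/\ 1 < L, (2 <= N)%N & (forall i : 'I_N, val i = 0%N -> nu i = (0, 0))],
      [/\ compact K, K !=set0 & K = \bigcup_(i in [set: 'I_N]) (Psi L nu i @` K)],
      [/\ V0 = essential_fixed_points L nu,
          injective v, V0 = range v &
          regular_polygon V0 k],
      (exists U : set pt, [/\ open U, U !=set0,
          (forall i, Psi L nu i @` U `<=` U) &
          (forall i j, i <> j -> Psi L nu i @` U `&` Psi L nu j @` U = set0)]) &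
      [/\
      (forall (n : nat) (w w' : seq 'I_N), size w = n -> size w' = n -> w <> w' ->
         PsiW L nu w @` K `&` PsiW L nu w' @` K
         = PsiW L nu w @` V0 `&` PsiW L nu w' @` V0),
      (forall x y, V0 x -> V0 y -> x <> y -> forall n : nat,
         reflect_bisector x y @` Vn L nu V0 n `<=` Vn L nu V0 n) &
      (forall i j : 'I_N, clos_refl_trans 'I_N
         (fun a b => Psi L nu a @` V0 `&` Psi L nu b @` V0 !=set0) i j)]].

(* shift nu_{Delta_M} = sum_{j=M+1}^{J} L^j nu_{i_j}, word w = (i_{M+1},...,i_J) *)
Definition complex_shift (L : R) N (nu : 'I_N -> pt) (M : int) (w : seq 'I_N) : pt :=
  (\sum_(t < size w) (L ^ (M + 1 + (t : nat)%:Z)) * (nu (tnth (in_tuple w) t)).1,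
   \sum_(t < size w) (L ^ (M + 1 + (t : nat)%:Z)) * (nu (tnth (in_tuple w) t)).2).

Definition VMM (L : R) (V0 : set pt) (M : int) : set pt :=
  pscale (L ^ M) @` V0.

Definition complex_vertices (L : R) N (nu : 'I_N -> pt) (V0 : set pt) (M : int)
    (w : seq 'I_N) : set pt :=
  (fun v => padd v (complex_shift L nu M w)) @` VMM L V0 M.

Definition VMinf (L : R) N (nu : 'I_N -> pt) (V0 : set pt) (M : int) : set pt :=
  [set z | exists w : seq 'I_N, (0 < size w)%N /\ complex_vertices L nu V0 M w z].

(* barycenter of K^<M> : the centre of the regular polygon V_M^<M> *)
Definition barycenterM (L : R) (k : nat) (v : 'I_k -> pt) (M : int) : pt :=
  pscale (k%:R^-1)
    (\sum_(j < k) (pscale (L ^ M) (v j)).1, \sum_(j < k) (pscale (L ^ M) (v j)).2).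

Definition rotationsM (L : R) (V0 : set pt) (k : nat) (v : 'I_k -> pt) (M : int)
    (rho : pt -> pt) : Prop :=
  exists a b : R, a ^+ 2 + b ^+ 2 = 1 /\
    rho = rotation_about (barycenterM L v M) a b /\
    rho @` VMM L V0 M = VMM L V0 M.

Definition good_labelling (L : R) N (nu : 'I_N -> pt) (V0 : set pt) (k : nat)
    (v : 'I_k -> pt) (M : int) (ell : pt -> 'I_k) : Prop :=
  (forall a : 'I_k, exists! x, VMM L V0 M x /\ ell x = a) /\
  (forall w : seq 'I_N, (0 < size w)%N ->
     exists rho, rotationsM L V0 v M rho /\
       forall x, complex_vertices L nu V0 M w x ->
         ell x = ell (rho (psub x (complex_shift L nu M w)))).

(* ell is only relevant on V_M^<infty>; a total function is used for convenience *)
Definition good_labelling_property (L : R) N (nu : 'I_N -> pt) (V0 : set pt)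
    (k : nat) (v : 'I_k -> pt) : Prop :=
  exists (M : int) (ell : pt -> 'I_k), good_labelling L nu V0 v M ell.

End Plane.

(* Main.v *)
Require Import Defs.
From mathcomp Require Import all_boot all_order all_algebra all_field.
From mathcomp Require Import complex zify ring lra.
From Stdlib Require Import Relations.
From mathcomp Require Import all_classical all_reals all_analysis.
Set Implicit Arguments. Unset Strict Implicit. Unset Printing Implicit Defensive.
Import Order.TTheory GRing.Theory Num.Theory numFieldNormedType.Exports.
Local Open Scope classical_set_scope.
Local Open Scope ring_scope.

(** Since k = N, the maps Psi_i are the homotheties of ratio 1/L centred at the
    vertices p_i of the regular k-gon, i in Z/k.  The cells at the corners i and
    i' share their vertices p_a and p_b iff p_a - p_b = (L - 1) (p_i' - p_i).
    The point is that a - b = d (i' - i) in Z/k for a constant d.  Then giving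
    the vertex p_j + sum_(t >= 1) L^t nu_(i_t) the label
    j + sum_(t >= 1) d (1 + d)^(t-1) i_t (with nu_0 = 0) is consistent: two cells
    of the same size that meet do so through corners of the complexes at the
    highest level where their addresses differ, and there the labels agree by the
    choice of d.

    Existence of d: nesting forbids two cells to have two points in common, since
    the intersection would then contain a vertex of a deeper cell that is not an
    extreme point.  If L = 2, then (a, b) = (i', i) is the only solution and d = 1.
    If L <> 2, then i' - i takes only the values m and -m: for k even, uniqueness
    applied to the solution (-p_b, -p_a) (centre at the origin) gives p_a = - p_b,
    which determines |p_i' - p_i|; for k odd, the Galois conjugation
    zeta |-> zeta^2 turns the equation into one about the sums p_a + p_b and
    p_i + p_i', which together with the original one determines |p_i' - p_i|.
    Connectivity then forces m to be invertible modulo k. *)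

(** * Galois conjugation of roots of unity *)

Lemma root_Cyclotomic (F : numFieldType) (n : nat) (z : F) :
  n.-primitive_root z -> root (map_poly intr 'Phi_n) z.
Proof.
move=> prz; have n_gt0 := prim_order_gt0 prz.
have evalX m (y : F) :
    \prod_(d <- divisors m | true) (map_poly intr 'Phi_d).[y] = y ^+ m - 1 \/ m = 0%N.
  have [->|m_gt0] := posnP m; [by right | left].
  rewrite -horner_prod -rmorph_prod prod_Cyclotomic //.
  by rewrite rmorphB rmorph1 /= map_polyXn !hornerE.
have [Ez|n0] := evalX n z; last by rewrite n0 in n_gt0.
(* Some factor ['Phi_d] of X^n - 1 vanishes at [z]; then z^d = 1, so [n] divides [d]. *)
move/eqP: Ez; rewrite (prim_expr_order prz) subrr prodf_seq_eq0.
case/hasP=> d; rewrite -dvdn_divisors //= => d_dvd_n rd.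
have d_gt0 := dvdn_gt0 n_gt0 d_dvd_n.
have [Ed|d0] := evalX d z; last by rewrite d0 in d_gt0.
suff n_dvd_d : (n %| d)%N by have /eqP -> : n == d by rewrite eqn_dvd n_dvd_d.
rewrite (prim_order_dvd prz) -subr_eq0 -Ed.
by rewrite (bigD1_seq d) /= ?divisors_uniq -?dvdn_divisors // (eqP rd) mul0r.
Qed.

(** The gcd of [p] and ['Phi_n] over the rationals is not constant. A root of it in [algC] is a
    primitive [n]-th root of unity, with minimal polynomial ['Phi_n]; hence ['Phi_n] divides [p],
    and it vanishes at [z ^+ m]. *)
Lemma primitive_root_conjugate (F : numFieldType) (n m : nat) (z : F)
    (p : {poly int}) :
  n.-primitive_root z -> coprime m n ->
  root (map_poly intr p) z -> root (map_poly intr p) (z ^+ m).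
Proof.
move=> prz co_mn rpz.
have toQ (G : numFieldType) (q : {poly int}) :
    map_poly (intr : int -> G) q = map_poly ratr (map_poly (intr : int -> rat) q).
  by rewrite -map_poly_comp; apply: eq_map_poly => x /=; rewrite ratr_int.
have przm : n.-primitive_root (z ^+ m) by rewrite prim_root_exp_coprime.
set P := map_poly (intr : int -> rat) p.
set Q := map_poly (intr : int -> rat) 'Phi_n.
suff QP : Q %| P.
  have /dvdpP[c Dc] : map_poly (ratr : rat -> F) Q %| map_poly ratr P.
    by rewrite dvdp_map.
  by rewrite toQ -/P Dc rootM -toQ (root_Cyclotomic przm) orbT.
have : size (gcdp P Q) != 1%N.
  apply/negP => sz1.
  have cop : coprimep (map_poly (ratr : rat -> F) P) (map_poly ratr Q).
    by rewrite coprimep_map.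
  have := coprimep_root cop (x := z); rewrite /root in rpz *.
  by rewrite -!toQ (eqP rpz) => /(_ (eqxx _))/negP; apply; apply: root_Cyclotomic.
rewrite -(size_map_poly (ratr : {rmorphism rat -> algC})).
case/closed_rootP=> y; rewrite gcdp_map root_gcd => /andP[rPy rQy].
have n_gt0 := prim_order_gt0 prz.
have [w prw] := C_prim_root_exists n_gt0.
have pry : n.-primitive_root y.
  by rewrite -(root_cyclotomic prw) -(Cintr_Cyclotomic prw) toQ.
have [q [Dq _] dvd_q] := minCpolyP y.
have -> : Q = q.
  apply: (map_inj_poly (fmorph_inj (ratr : {rmorphism rat -> algC})) (rmorph0 _)).
  transitivity (minCpoly y); last exact: Dq.
  by rewrite (minCpoly_cyclotomic pry) -(Cintr_Cyclotomic pry) toQ.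
by rewrite -dvd_q.
Qed.
(* With [z] a primitive root of unity and [lam = L - 1]: the cells at the corners
   [i] and [i'] share the vertices numbered [a] and [b] in them, respectively. *)
Definition touching (C : numClosedFieldType) (z lam : C) (n : nat)
    (i i' a b : 'I_n.+2) : Prop :=
  i != i' /\ z ^+ a - z ^+ b = lam * (z ^+ i' - z ^+ i).

(** * Arithmetic of the contacts between first-level cells *)

Section Touching.
Variables (C : numClosedFieldType) (n : nat) (z lam : C).
Hypothesis prz : n.+2.-primitive_root z.
Hypothesis lam_ge0 : 0 <= lam.
Local Notation touching := (@touching C z lam n).
Implicit Types i j a b : 'I_n.+2.

Let zD i j : z ^+ (i + j)%R = z ^+ i * z ^+ j.
Proof. by rewrite -exprD -(prim_expr_mod prz (i + j)%N). Qed.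

Let z_inj i j : z ^+ i = z ^+ j -> i = j.
Proof.
move/eqP; rewrite (eq_prim_root_expr prz) !modn_small //.
by move/eqP/val_inj.
Qed.

Let z_neq0 : z != 0.
Proof.
apply/eqP => z0; have := prim_expr_order prz.
by rewrite z0 expr0n => /eqP; rewrite eq_sym oner_eq0.
Qed.

Let conj_z : z^* = z^-1.
Proof.
have n1 : `|z| = 1.
  apply/eqP; rewrite -(@pexpr_eq1 _ _ n.+2) ?normr_ge0 //.
  by rewrite -normrX (prim_expr_order prz) normr1.
by rewrite invC_norm n1 expr1n invr1 mul1r.
Qed.

Let conj_lam : lam^* = lam.
Proof. exact/CrealP/ger0_real. Qed.

Lemma touching_opp i i' a b : touching i i' a b -> touching i' i b a.
Proof.
by move=> [ne e]; split; rewrite 1?eq_sym // -opprB e -mulrN opprB.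
Qed.

Lemma touching_shift s i i' a b :
  touching i i' a b -> touching (i + s) (i' + s) (a + s) (b + s).
Proof.
move=> [ne e]; split; first by rewrite (inj_eq (addIr s)).
by rewrite !zD -!mulrBl e mulrA.
Qed.

Let tneq0 i i' a b : touching i i' a b -> z ^+ i' - z ^+ i != 0.
Proof.
by move=> [ne _]; rewrite subr_eq0; apply: contra ne => /eqP/z_inj->.
Qed.

(* The chords [a b] and [i i'] are parallel, i.e. perpendicular to the same
   axis of symmetry. *)
Lemma touching_prod i i' a b : lam != 0 -> touching i i' a b ->
  z ^+ a * z ^+ b = z ^+ i * z ^+ i'.
Proof.
move=> lam0 t; have := tneq0 t; case: t => ne e ne0.
(* Conjugation inverts the powers of [z] and fixes [lam]. *)
have := congr1 (fun x => x^*) e.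
rewrite rmorphM !rmorphB !rmorphXn /= conj_z conj_lam => e'.
have u k : z ^+ k != 0 by rewrite expf_neq0.
have [[[ua ub] ui] ui'] := (u a, u b, u i, u i').
rewrite !exprVn in e'.
have /eqP : lam * (z ^+ i' - z ^+ i) * (z ^+ a * z ^+ b - z ^+ i * z ^+ i') = 0.
  have -> : lam * (z ^+ i' - z ^+ i) * (z ^+ a * z ^+ b - z ^+ i * z ^+ i')
     = - (lam * ((z ^+ i')^-1 - (z ^+ i)^-1)) * (z ^+ a * z ^+ b * z ^+ i * z ^+ i')
       - lam * (z ^+ i' - z ^+ i) * (z ^+ i * z ^+ i').
    by field; rewrite ui ui'.
  rewrite -e' -e; field; by rewrite ua ub.
by rewrite !mulf_eq0 (negbTE lam0) (negbTE ne0) /= subr_eq0 => /eqP.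
Qed.

(* The relation [(z^a1 - z^b1) * (z^i2' - z^i2) = (z^a2 - z^b2) * (z^i1' - z^i1)]
   is conjugated by [z |-> z ^ 2] and divided by the original one. *)
Lemma touching_sum (i1 i1' a1 b1 i2 i2' a2 b2 : 'I_n.+2) :
  lam != 0 -> odd n -> touching i1 i1' a1 b1 -> touching i2 i2' a2 b2 ->
  (z ^+ a1 + z ^+ b1) * (z ^+ i2' + z ^+ i2)
    = (z ^+ a2 + z ^+ b2) * (z ^+ i1' + z ^+ i1).
Proof.
move=> lam0 n_odd t1 t2; have [n1 n2] := (tneq0 t1, tneq0 t2).
case: t1 t2 => _ e1 [_ e2].
(* Eliminating [lam] leaves integer coefficients, so that the conjugation applies. *)
pose p : {poly int} := ('X^a1 - 'X^b1) * ('X^i2' - 'X^i2)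
   - ('X^a2 - 'X^b2) * ('X^i1' - 'X^i1).
have Ep x : (map_poly intr p).[x] = (x ^+ a1 - x ^+ b1) * (x ^+ i2' - x ^+ i2)
   - (x ^+ a2 - x ^+ b2) * (x ^+ i1' - x ^+ i1) :> C.
  by rewrite /p !(rmorphB, rmorphM) /= !map_polyXn !hornerE.
have : root (map_poly intr p) (z ^+ 2).
  apply: (primitive_root_conjugate prz); first by rewrite coprime2n /= negbK.
  by rewrite /root Ep e1 e2; apply/eqP; ring.
rewrite /root Ep -!exprM ![(2 * _)%N]mulnC !exprM !subr_sqr => /eqP e.
apply/eqP; rewrite -subr_eq0.
have /eqP : lam * (z ^+ i1' - z ^+ i1) * (z ^+ i2' - z ^+ i2)
   * ((z ^+ a1 + z ^+ b1) * (z ^+ i2' + z ^+ i2) -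
      (z ^+ a2 + z ^+ b2) * (z ^+ i1' + z ^+ i1)) = 0.
  by rewrite -[RHS]e e1 e2; ring.
by rewrite !mulf_eq0 (negbTE lam0) (negbTE n1) (negbTE n2).
Qed.

Hypothesis touching_uniq : forall i i' a b a' b',
  touching i i' a b -> touching i i' a' b' -> a = a'.

Let touching_uniq2 i i' a b a' b' :
  touching i i' a b -> touching i i' a' b' -> b = b'.
Proof.
by move=> /touching_opp t /touching_opp t'; apply: touching_uniq t t'.
Qed.

(** The chords from [i1] to [i1'] and from [i2] to [i2'] have the same length. *)
Lemma touching_diff (i1 i1' a1 b1 i2 i2' a2 b2 : 'I_n.+2) :
  lam != 0 -> lam != 1 -> touching i1 i1' a1 b1 -> touching i2 i2' a2 b2 ->
  i2' - i2 = i1' - i1 \/ i2' - i2 = - (i1' - i1).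
Proof.
move=> lam0 lam1 t1 t2.
(* [E] compares squared lengths, as |z^i' - z^i|^2 = - (z^i' - z^i)^2 / (z^i z^i'). *)
suff E : (z ^+ i1' - z ^+ i1) ^+ 2 * (z ^+ i2 * z ^+ i2')
       = (z ^+ i2' - z ^+ i2) ^+ 2 * (z ^+ i1 * z ^+ i1').
  have /eqP : (z ^+ i1' * z ^+ i2 - z ^+ i2' * z ^+ i1) *
              (z ^+ i1' * z ^+ i2' - z ^+ i1 * z ^+ i2) = 0.
    by move/eqP: E; rewrite -subr_eq0 => /eqP <-; ring.
  rewrite mulf_eq0 !subr_eq0 -!zD => /orP[/eqP/z_inj e|/eqP/z_inj e].
    by left; apply/eqP; rewrite subr_eq addrAC eq_sym subr_eq e.
  by right; apply/eqP; rewrite opprB subr_eq addrAC eq_sym subr_eq -e addrC.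
have [p1 p2] := (touching_prod lam0 t1, touching_prod lam0 t2).
have [n_odd|n_even] := boolP (odd n).
  have s := touching_sum lam0 n_odd t1 t2.
  case: t1 t2 => _ e1 [_ e2].
  have q1 : (z ^+ a1 + z ^+ b1) ^+ 2
      = lam ^+ 2 * (z ^+ i1' - z ^+ i1) ^+ 2 + 4 * (z ^+ i1 * z ^+ i1').
    by rewrite -p1 -exprMn -e1; ring.
  have q2 : (z ^+ a2 + z ^+ b2) ^+ 2
      = lam ^+ 2 * (z ^+ i2' - z ^+ i2) ^+ 2 + 4 * (z ^+ i2 * z ^+ i2').
    by rewrite -p2 -exprMn -e2; ring.
  have s2 := congr1 (fun x => x ^+ 2) s; rewrite /= !exprMn q1 q2 in s2.
  apply/eqP; rewrite -subr_eq0.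
  (* Since (z^i' + z^i)^2 = (z^i' - z^i)^2 + 4 z^i z^i', only terms with the factor [lam ^+ 2 - 1]
     survive in [s2]. *)
  have /eqP : 4 * (lam ^+ 2 - 1) *
     ((z ^+ i1' - z ^+ i1) ^+ 2 * (z ^+ i2 * z ^+ i2') -
      (z ^+ i2' - z ^+ i2) ^+ 2 * (z ^+ i1 * z ^+ i1')) = 0.
    by move/eqP: s2; rewrite -subr_eq0 => /eqP <-; ring.
  rewrite !mulf_eq0 pnatr_eq0 /= => /orP[l1|//].
  by case/negP: lam1; rewrite -(sqrp_eq1 lam_ge0) -subr_eq0.
(* For [n] even, [-1] is a power of [z], so [(- z ^ b, - z ^ a)] is a solution
   whenever [(z ^ a, z ^ b)] is. *)
have [h zh] : exists h : 'I_n.+2, z ^+ h = -1.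
  have h_lt : (n.+2./2 < n.+2)%N by rewrite -divn2 ltn_Pdiv.
  exists (Ordinal h_lt) => /=; apply/eqP; rewrite -[_ == _]orFb.
  have <- : (z ^+ n.+2./2 == 1) = false.
    by apply/negbTE; rewrite -(prim_order_dvd prz) gtnNdvd.
  rewrite -eqf_sqr expr1n -exprM muln2 halfK /= negbK (negbTE n_even) subn0.
  by rewrite (prim_expr_order prz).
have opp i i' a b : touching i i' a b -> z ^+ b = - z ^+ a.
  move=> t; have t' : touching i i' (b + h) (a + h).
    by case: t => ne e; split=> //; rewrite !zD zh -e; ring.
  by rewrite (touching_uniq t t') zD zh; ring.
have [E1 E2] := (opp _ _ _ _ t1, opp _ _ _ _ t2).
case: t1 t2 => _ e1 [_ e2]; rewrite E1 E2 in p1 p2 e1 e2.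
(* The chord from [a] to [b] is now a diameter, so lam^2 (z^i' - z^i)^2 = - 4 z^i z^i' for both
   contacts. *)
apply: (mulfI (expf_neq0 2 lam0)).
by rewrite -p1 -p2 [LHS]mulrA [RHS]mulrA -!exprMn -e1 -e2; ring.
Qed.

Lemma touching_slope :
  lam != 0 ->
  (forall i j, clos_refl_trans _ (fun i i' =>
     i = i' \/ exists a b, touching i i' a b) i j) ->
  exists d : 'I_n.+2, forall i i' a b, touching i i' a b -> a - b = d * (i' - i).
Proof.
move=> lam0 conn.
have [lam1|lam1] := eqVneq lam 1.
  exists 1 => i i' a b t; rewrite mul1r.
  have t' : touching i i' i' i by case: t => ne _; split; rewrite // lam1 mul1r.
  by rewrite (touching_uniq t t') (touching_uniq2 t t').
have [[i0 [i0' [a0 [b0 t0]]]]|none] := EM (exists i i' a b, touching i i' a b); last first.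
  by exists 0 => i i' a b t; case: none; exists i, i', a, b.
set m := i0' - i0; set e := a0 - b0.
have dm i i' a b : touching i i' a b ->
    i' - i = m /\ a - b = e \/ i' - i = - m /\ a - b = - e.
  (* Rotating [j] to [i0] makes the contact comparable with [t0], and uniqueness identifies the
     two. *)
  have same j j' c c' : touching j j' c c' -> j' - j = m -> c - c' = e.
    move=> t ej; have := touching_shift (i0 - j) t.
    have -> : j + (i0 - j) = i0 by ring.
    have -> : j' + (i0 - j) = i0' by rewrite -[LHS](addrC) -addrA [- j + _]addrC ej /m; ring.
    move=> t1; rewrite /e -(touching_uniq t1 t0) -(touching_uniq2 t1 t0); ring.
  move=> t; have [E|E] := touching_diff lam0 lam1 t0 t; [left|right]; split=> //.
    exact: same t E.
  apply: oppr_inj; rewrite opprB opprK; apply: same (touching_opp t) _.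
  by rewrite -opprB E opprK.
have [c cm] : exists c, c * m = 1.
  (* Along a chain of contacts from 0 to 1 each step is 0, [m] or [- m], so 1 is a multiple of
     [m]. *)
  suff /(_ 0 1 (conn _ _)) : forall i j, clos_refl_trans _ (fun i i' =>
     i = i' \/ exists a b, touching i i' a b) i j -> exists c, c * m = j - i.
    by rewrite subr0.
  move=> i j; elim=> {i j} [i j [->|[a [b t]]]|i|i j k _ [c1 E1] _ [c2 E2]].
  - by exists 0; rewrite mul0r subrr.
  - have [[-> _]|[-> _]] := dm _ _ _ _ t; first by exists 1; rewrite mul1r.
    by exists (-1); rewrite mulN1r.
  - by exists 0; rewrite mul0r subrr.
  - by exists (c1 + c2); rewrite mulrDl E1 E2; ring.
exists (c * e) => i i' a b /dm[[-> ->]|[-> ->]]; last rewrite mulrN.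
  by rewrite mulrAC cm mul1r.
by rewrite mulrAC cm mul1r.
Qed.
End Touching.

(** * Complex coordinates and the regular polygon *)

Section PlaneAsComplex.
Variable R : realType.
Implicit Types (x y c : R * R) (a b t : R).

Definition toC x : R[i] := Complex x.1 x.2.

Lemma toC_inj : injective toC.
Proof. by move=> [x1 x2] [y1 y2] [-> ->]. Qed.

Lemma toC_padd x y : toC (padd x y) = toC x + toC y.
Proof. by []. Qed.

Lemma toC_pscale a x : toC (pscale a x) = (real_complex R a) * toC x.
Proof. by apply/eqP; rewrite eq_complex /= !mul0r subr0 addr0 !eqxx. Qed.

Lemma toC_sum (I : finType) (f : I -> R * R) :
  toC (\sum_i (f i).1, \sum_i (f i).2) = \sum_i toC (f i).
Proof.
rewrite /toC /=; elim/big_rec3: _ => // i y1 y2 y3 _ <-.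
by [].
Qed.

Lemma toC_rotation_about c a b x :
  toC (rotation_about c a b x) = toC c + Complex a b * (toC x - toC c).
Proof. by apply/eqP; rewrite eq_complex /= [_ * (_ - c.2) + _]addrC !eqxx. Qed.

Definition expi t : R[i] := Complex (cos t) (sin t).

Lemma expiD s t : expi (s + t) = expi s * expi t.
Proof.
apply/eqP; rewrite eq_complex /= cosD sinD eqxx /=.
by apply/eqP; ring.
Qed.

Lemma expi0 : expi 0 = 1.
Proof. by rewrite /expi cos0 sin0. Qed.

Lemma expiMn t m : expi (t * m%:R) = expi t ^+ m.
Proof.
elim: m => [|m IH]; first by rewrite mulr0 expi0.
by rewrite exprSr -IH -expiD; congr expi; rewrite -natr1; ring.
Qed.

(** [expi t] is the square of [expi (t / 2)], which is neither 1 nor -1 because its imaginary part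
    is positive. *)
Lemma expi_neq1 t : 0 < t < 2 * pi -> expi t != 1.
Proof.
move=> /andP[t0 t2]; have -> : t = t / 2 * 2%:R by field.
rewrite expiMn sqrf_eq1 !eq_complex /= oppr0.
have : 0 < sin (t / 2) by apply: sin_gt0_pi; apply/andP; split; lra.
by move=> /gt_eqF ->; rewrite !andbF.
Qed.

Lemma expi_prim k : (0 < k)%N -> k.-primitive_root (expi (2 * pi / k%:R)).
Proof.
move=> k0; have kR : 0 < k%:R :> R by rewrite ltr0n.
have pi0 : 0 < pi :> R by exact: pi_gt0.
have zk : expi (2 * pi / k%:R) ^+ k = 1.
  rewrite -expiMn (_ : _ * _ = pi + pi); last by field; rewrite gt_eqF.
  rewrite expiD; apply/eqP; rewrite eq_complex /= cospi sinpi.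
  by rewrite !mulr0 !mul0r subr0 addr0 mulrNN mulr1 !eqxx.
have [m prm dvd] := prim_order_exists k0 zk.
suff km : k = m by rewrite {1}km.
apply/eqP; rewrite eqn_leq [(m <= k)%N]dvdn_leq // andbT leqNgt.
(* An order [m] below [k] would put the angle 2 pi m / k strictly between 0 and 2 pi. *)
apply/negP => mk; have := prim_expr_order prm; rewrite -expiMn; apply/eqP.
have m0 := prim_order_gt0 prm; apply: expi_neq1; apply/andP; split.
  by rewrite mulr_gt0 ?divr_gt0 ?mulr_gt0 ?ltr0n.
rewrite mulrAC ltr_pdivrMr // ltr_pM2l ?mulr_gt0 //.
by rewrite ltr_nat.
Qed.
End PlaneAsComplex.

(** [rho] carries the radius and the initial angle. The complex form serves the arithmetic of
    contacts, the constant distance to [c] the extremality of the vertices. *)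
Lemma regular_polygonP (R : realType) (V : set (R * R)) (k : nat) :
  (0 < k)%N -> regular_polygon V k ->
  exists (c : R * R) (r : R) (rho : R[i]) (P : 'I_k -> R * R),
    [/\ V = range P, rho != 0,
      (forall j, toC (P j) = toC c + rho * expi (2 * pi / k%:R) ^+ j) &
      (forall j, pdot (psub (P j) c) (psub (P j) c) = r ^+ 2)].
Proof.
move=> k0 [c [r [t0 [r0 ->]]]].
exists c, r, (real_complex R r * expi t0), (fun j : 'I_k => padd c
  (r * cos (t0 + 2 * pi * j%:R / k%:R), r * sin (t0 + 2 * pi * j%:R / k%:R))).
split.
- by apply/seteqP; split=> x [j]; [move=> ->; exists j | move=> _ <-; exists j].
- apply/eqP => E; have := congr1 (fun x : R[i] => complex.Re x ^+ 2 + complex.Im x ^+ 2) E.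
  rewrite /= !mul0r subr0 addr0 !exprMn -mulrDr cos2Dsin2 mulr1.
  by rewrite expr0n /= addr0 => /eqP; rewrite sqrf_eq0 gt_eqF.
- move=> j; rewrite toC_padd -expiMn; congr (_ + _); rewrite -[RHS]mulrA -expiD.
  rewrite (_ : 2 * pi / k%:R * j%:R = 2 * pi * j%:R / k%:R); last by ring.
  by apply/eqP; rewrite eq_complex /= !mul0r subr0 addr0 !eqxx.
- move=> j; rewrite /pdot /psub /= ![c.1 + _]addrC ![c.2 + _]addrC !addrK.
  by rewrite -!expr2 !exprMn -mulrDr cos2Dsin2 mulr1.
Qed.

(** * Fixed points in the fractal, and shifts of complexes *)

Lemma compact_fixed_point (R : realType) (L : R) (N : nat) (nu : 'I_N -> R * R)
    (K : set (R * R)) (i : 'I_N) (x : R * R) :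
  1 < L -> compact K -> K !=set0 -> Psi L nu i @` K `<=` K -> Psi L nu i x = x ->
  K x.
Proof.
move=> L1 cK [y Ky] sub fx.
have L0 : 0 < L by lra.
have Kc : closed K by apply: compact_closed cK; exact: norm_hausdorff.
have nuE : nu i = (x.1 - L^-1 * x.1, x.2 - L^-1 * x.2).
  have := congr1 fst fx; have := congr1 snd fx; rewrite /= => f2 f1.
  by rewrite [LHS]surjective_pairing; congr pair; lra.
(* [u m] is the [m]-th iterate of [y] in closed form; it stays in the closed set [K] and tends to
   [x]. *)
pose u m : R * R := (x.1 + (y.1 - x.1) * L^-1 ^+ m, x.2 + (y.2 - x.2) * L^-1 ^+ m).
have Ku m : K (u m).
  elim: m => [|m IH].
    by rewrite /u !expr0 !mulr1 ![_ + (_ - _)]addrC !subrK -surjective_pairing.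
  apply: sub; exists (u m) => //.
  by rewrite /Psi /padd /pscale nuE /u /= !exprS; congr pair; ring.
apply: (@closed_cvg _ _ \oo _ u K Kc); first by near=> m; exact: Ku.
have cvg1 a b : (fun m : nat => a + b * L^-1 ^+ m) @ \oo --> a.
  rewrite -[X in _ --> X]addr0; apply: cvgD; first exact: cvg_cst.
  apply: cvg_geometric; rewrite ger0_norm ?invr_ge0 ?ltW //.
  by rewrite invf_lt1.
rewrite [x]surjective_pairing.
have := cvg_pair (cvg1 x.1 (y.1 - x.1)) (cvg1 x.2 (y.2 - x.2)); exact.
Unshelve. all: by end_near.
Qed.

Lemma Psi_inj (R : realType) (L : R) (N : nat) (nu : 'I_N -> R * R) (i : 'I_N) :
  1 < L -> injective (Psi L nu i).
Proof.
move=> L1 [x1 x2] [y1 y2] [/addIr e1 /addIr e2].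
have L0 : L^-1 != 0 by rewrite invr_neq0 // gt_eqF //; lra.
by rewrite (mulfI L0 e1) (mulfI L0 e2).
Qed.

Lemma complex_shift_nil (R : realType) (L : R) (N : nat) (nu : 'I_N -> R * R) :
  complex_shift L nu 0 [::] = (0, 0).
Proof. by rewrite /complex_shift /= !big_ord0. Qed.

Lemma complex_shift_rcons (R : realType) (L : R) (n : nat)
    (nu : 'I_n.+1 -> R * R) (w : seq 'I_n.+1) (i : 'I_n.+1) :
  complex_shift L nu 0 (rcons w i)
    = padd (complex_shift L nu 0 w) (pscale (L ^+ (size w).+1) (nu i)).
Proof.
have E (f : 'I_n.+1 -> R) u : \sum_(t < size u) (L ^ (0 + 1 + (t : nat)%:Z)) *
    f (tnth (in_tuple u) t) = \sum_(0 <= t < size u) L ^+ t.+1 * f (nth ord0 u t).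
  rewrite big_mkord; apply: eq_bigr => t _.
  by rewrite (tnth_nth ord0) add0r -PoszD add1n.
have E' (f : 'I_n.+1 -> R) : \sum_(0 <= t < size (rcons w i)) L ^+ t.+1 *
     f (nth ord0 (rcons w i) t) =
     \sum_(0 <= t < size w) L ^+ t.+1 * f (nth ord0 w t) + L ^+ (size w).+1 * f i.
  rewrite size_rcons big_nat_recr //= nth_rcons ltnn eqxx; congr (_ + _).
  by apply: eq_big_nat => t /andP[_ t_lt]; rewrite nth_rcons t_lt.
rewrite /complex_shift (E (fun i => (nu i).1)) (E (fun i => (nu i).2)).
rewrite (E' (fun i => (nu i).1)) (E' (fun i => (nu i).2)).
by rewrite /padd /pscale (E (fun i => (nu i).1)) (E (fun i => (nu i).2)).
Qed.

(** Scaling down by [L ^+ size w] turns a complex into a cell. [complex_shift] lists the levels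
    upwards, whereas the first letter in [PsiW] is the outermost map; hence [rev]. *)
Lemma padd_complex_shift (R : realType) (L : R) (n : nat)
    (nu : 'I_n.+1 -> R * R) (w : seq 'I_n.+1) (x : R * R) : L != 0 ->
  padd x (complex_shift L nu 0 w) = pscale (L ^+ size w) (PsiW L nu (rev w) x).
Proof.
move=> L0; elim/last_ind: w => [|w i IH].
  by rewrite complex_shift_nil /padd /pscale /= !addr0 !mul1r.
rewrite complex_shift_rcons rev_rcons size_rcons /=.
rewrite (_ : padd x _ = padd (padd x (complex_shift L nu 0 w))
   (pscale (L ^+ (size w).+1) (nu i))); last by rewrite /padd /= !addrA.
by rewrite IH /Psi /padd /pscale /= !exprSr; congr pair; field.
Qed.

(** * Geometry of the contacts between cells *)

Section Labelling.
Variables (R : realType) (L : R) (n : nat) (nu : 'I_n.+2 -> R * R).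
Variables (K : set (R * R)) (c : R * R) (r : R) (rho : R[i]).
(** [tau i] is the number of the vertex that [Psi i] fixes. *)
Variables (P : 'I_n.+2 -> R * R) (tau : 'I_n.+2 -> 'I_n.+2).
Local Notation V0 := (range P).
Local Notation Psi := (@Psi R L n.+2 nu).
Local Notation PsiW := (@PsiW R L n.+2 nu).
Local Notation zeta := (expi (2 * pi / n.+2%:R) : R[i]).
Local Notation LC := (real_complex R L).
Local Notation touching := (@touching R[i] zeta (LC - 1) n).
Implicit Types (i j a b : 'I_n.+2) (u w : seq 'I_n.+2) (x y : R * R).

Hypothesis L1 : 1 < L.
Hypothesis rho0 : rho != 0.
Hypothesis PE : forall j, toC (P j) = toC c + rho * zeta ^+ j.
Hypothesis Pr : forall j, pdot (psub (P j) c) (psub (P j) c) = r ^+ 2.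
Hypothesis nuE : forall i, nu i = pscale (1 - L^-1) (P (tau i)).
Hypothesis tau_bij : bijective tau.
Hypothesis V0K : V0 `<=` K.
Hypothesis PsiK : forall i, Psi i @` K `<=` K.
Hypothesis nesting : forall i j, i <> j ->
  Psi i @` K `&` Psi j @` K `<=` Psi i @` V0 `&` Psi j @` V0.
Hypothesis connected : forall i j, clos_refl_trans _
  (fun a b => Psi a @` V0 `&` Psi b @` V0 !=set0) i j.
Hypothesis nu0 : nu ord0 = (0, 0).

Let prz : n.+2.-primitive_root zeta.
Proof. exact: expi_prim. Qed.

Let L0 : 0 < L.
Proof. exact: lt_trans ltr01 L1. Qed.

Let LC0 : LC != 0.
Proof. by rewrite fmorph_eq0 gt_eqF. Qed.

Let P_inj : injective P.
Proof.
move=> i j /(congr1 (@toC R)); rewrite !PE => /addrI/(mulfI rho0)/eqP.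
rewrite (eq_prim_root_expr prz) !modn_small //.
by move/eqP/val_inj.
Qed.

Let toC_Psi i x :
  toC (Psi i x) = LC^-1 * toC x + (1 - LC^-1) * toC (P (tau i)).
Proof. by rewrite toC_padd nuE !toC_pscale rmorphB rmorph1 !fmorphV. Qed.

Lemma Psi_touching i i' a b : tau i != tau i' ->
  Psi i (P a) = Psi i' (P b) <-> touching (tau i) (tau i') a b.
Proof.
move=> ne.
have E : toC (Psi i (P a)) - toC (Psi i' (P b)) = LC^-1 * rho *
   ((zeta ^+ a - zeta ^+ b) - (LC - 1) * (zeta ^+ tau i' - zeta ^+ tau i)).
  by rewrite !toC_Psi !PE; field.
split=> [e|[_ e]].
  split=> //; move/eqP: E; rewrite e subrr eq_sym !mulf_eq0 invr_eq0.
  by rewrite (negbTE LC0) (negbTE rho0) /= subr_eq0 => /eqP.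
by apply: toC_inj; apply/eqP; rewrite -subr_eq0 E e subrr mulr0.
Qed.

Lemma PsiW_K u x : K x -> K (PsiW u x).
Proof.
by move=> Kx; elim: u => //= i u IH; apply: (PsiK (i := i)); exists (PsiW u x).
Qed.

(** Affine functional in the direction of the corner [P a]; among the vertices only [P a] attains
    its maximum [r ^+ 2]. *)
Let height a x := pdot (psub x c) (psub (P a) c).

Let height_P a j : height a (P j) <= r ^+ 2.
Proof.
rewrite /height; have := Pr a; have := Pr j; rewrite /pdot.
move: (psub (P j) c) (psub (P a) c) => [x1 x2] [y1 y2] /= e1 e2.
have := sqr_ge0 (x1 - y1); have := sqr_ge0 (x2 - y2); lra.
Qed.

Let height_P_eq a j : height a (P j) = r ^+ 2 -> j = a.
Proof.
rewrite /height; have := Pr a; have := Pr j; rewrite /pdot /psub /= => e1 e2 e3.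
apply: P_inj.
have : ((P j).1 - (P a).1) ^+ 2 + ((P j).2 - (P a).2) ^+ 2 = 0.
  transitivity (r ^+ 2 + r ^+ 2 - 2 * r ^+ 2); last by ring.
  by rewrite -{1}e1 -{1}e2 -e3; ring.
move/eqP; rewrite paddr_eq0 ?sqr_ge0 // !sqrf_eq0 !subr_eq0 => /andP[/eqP h1 /eqP h2].
by rewrite [LHS]surjective_pairing [RHS]surjective_pairing h1 h2.
Qed.

Let height_Psi a i x :
  height a (Psi i x) = L^-1 * height a x + (1 - L^-1) * height a (P (tau i)).
Proof. by rewrite /height /pdot /psub /Defs.Psi nuE /padd /pscale /=; ring. Qed.

Let iL : 0 < L^-1 < 1.
Proof. by rewrite invr_gt0 L0 invf_lt1. Qed.

Let height_PsiW a u j : height a (PsiW u (P j)) <= r ^+ 2.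
Proof.
elim: u => [|i u IH] /=; first exact: height_P.
rewrite height_Psi; have := height_P a (tau i); case/andP: iL; nra.
Qed.

(* A polygon vertex is an extreme point of the convex hull. *)
Lemma Psi_corner a i u j : Psi i (PsiW u (P j)) = P a ->
  tau i = a /\ PsiW u (P j) = P a.
Proof.
move=> e; have hr : height a (P a) = r ^+ 2 by exact: Pr.
have ia : tau i = a.
  (* The height of [P a] is an average, with positive weights, of two heights at most [r ^+ 2], so
     both reach this bound. *)
  apply: height_P_eq; have := height_Psi a i (PsiW u (P j)); rewrite e hr.
  have := height_PsiW a u j; have := height_P a (tau i); case/andP: iL; nra.
split=> //; apply: (@Psi_inj _ L _ nu i L1); rewrite e /Defs.Psi nuE ia /padd /pscale /=.
by rewrite [LHS]surjective_pairing; congr pair; ring.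
Qed.

Let cell i : {j | tau j = i}.
Proof. by apply: cid; case: tau_bij => g _ gK; exists (g i). Qed.

(* If [P a] and [P a'] are both contact points of two cells, then so is the image
   of [P a'] under the map fixing [P a]; but it is not a vertex. *)
Lemma touching_unique i i' a b a' b' :
  touching i i' a b -> touching i i' a' b' -> a = a'.
Proof.
have [j <-] := cell i; have [j' <-] := cell i'; move=> t t'; have [ne _] := t.
have e := (Psi_touching a b ne).2 t; have e' := (Psi_touching a' b' ne).2 t'.
have [ja tja] := cell a; have [jb tjb] := cell b.
have nejj : j <> j' by move=> jj; move: ne; rewrite jj eqxx.
(* Both sides are the average of the two contact points with weights 1 - 1/L and 1/L. *)
have E : Psi j (Psi ja (P a')) = Psi j' (Psi jb (P b')).
  apply: toC_inj; have := congr1 (@toC R) e; have := congr1 (@toC R) e'.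
  rewrite !toC_Psi tja tjb; set l := LC^-1 => e1 e2.
  transitivity (l * (l * toC (P a') + (1 - l) * toC (P (tau j)))
     + (1 - l) * (l * toC (P a) + (1 - l) * toC (P (tau j)))); first by ring.
  by rewrite e1 e2; ring.
have KP k d : K (Psi k (P d)) by apply: (PsiW_K [:: k]); apply: V0K; exists d.
have K1 : (Psi j @` K) (Psi j (Psi ja (P a'))) by exists (Psi ja (P a')).
have K2 : (Psi j' @` K) (Psi j (Psi ja (P a'))).
  by rewrite E; exists (Psi jb (P b')).
(* By nesting this point is the image under [Psi j] of a vertex, which by extremality is both [P a]
   and [P a']. *)
have [[_ [a'' _ <-] /(@Psi_inj _ L _ nu j L1) e''] _] := nesting nejj (conj K1 K2).
have [ea /P_inj ->] := @Psi_corner a'' ja [::] a' (esym e'').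
by rewrite -ea.
Qed.

Lemma slope_exists : exists d : 'I_n.+2, forall i i' a b,
  touching i i' a b -> a - b = d * (i' - i).
Proof.
have lE : LC - 1 = real_complex R (L - 1) by rewrite rmorphB rmorph1.
apply: (touching_slope prz).
- by rewrite lE ler0c subr_ge0 ltW.
- exact: touching_unique.
- by rewrite lE fmorph_eq0 subr_eq0 gt_eqF.
move=> i i'; have [j <-] := cell i; have [j' <-] := cell i'.
elim: (connected j j') => {i i' j j'} [i i' [x [[_ [a _ <-] xa] [_ [b _ <-] xb]]]|i|i j k _ h _ h'].
- apply: rt_step; have [->|ne] := eqVneq (tau i) (tau i'); [by left|right].
  by exists a, b; apply/Psi_touching => //; rewrite xa xb.
- exact: rt_refl.
- exact: rt_trans h h'.
Qed.

(** * The labels and their consistency *)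

Variable d : 'I_n.+2.
Hypothesis slopeP : forall i i' a b, touching i i' a b -> a - b = d * (i' - i).

(** The first letter has the highest level. Subtracting [tau ord0] gives no weight to the letter 0,
    whose shift is zero, so that addresses can be padded with it. *)
Fixpoint word_label u : 'I_n.+2 :=
  if u is i :: u' then
    word_label u' + d * (1 + d) ^+ size u' * (tau i - tau ord0)
  else 0.

(** By extremality every letter of [u] has the corner [a], and the label is a geometric sum of ratio
    1 + d. *)
Lemma corner_label a u j : PsiW u (P j) = P a ->
  j + word_label u = a + ((1 + d) ^+ size u - 1) * (a - tau ord0).
Proof.
elim: u => [/P_inj -> /=|i u IH /Psi_corner[ia /IH e]]; first by ring.
by rewrite /= ia addrA e exprS; ring.
Qed.

(** Equal first letters cancel. Otherwise nesting makes the common point a contact, at corners [P a]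
    and [P b]; by [corner_label] the labels differ by (1 + d)^m (a - b - d (tau i' - tau i)), with m
    the length of the tails, and this is zero by the choice of [d]. *)
Lemma label_PsiW u u' j j' : size u = size u' ->
  PsiW u (P j) = PsiW u' (P j') -> j + word_label u = j' + word_label u'.
Proof.
elim: u u' => [|i u IH] [|i' u'] //= => [_ /P_inj -> //|[sz] e].
have [ii'|ne] := eqVneq i i'.
  rewrite -ii' in e *; have := Psi_inj L1 e => /(IH _ sz) e'.
  by rewrite !addrA e' sz.
have KP v k : K (PsiW v (P k)) by apply: PsiW_K; apply: V0K; exists k.
have K1 : (Psi i @` K) (Psi i (PsiW u (P j))) by exists (PsiW u (P j)).
have K2 : (Psi i' @` K) (Psi i (PsiW u (P j))).
  by rewrite e; exists (PsiW u' (P j')).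
have [[_ [a _ <-] ea] [_ [b _ <-] eb]] := nesting (elimN eqP ne) (conj K1 K2).
have tne : tau i != tau i' by rewrite (inj_eq (bij_inj tau_bij)).
have t : touching (tau i) (tau i') a b by apply/(Psi_touching _ _ tne); rewrite ea eb.
have ca := corner_label (Psi_inj L1 (esym ea)).
rewrite e in eb; have cb := corner_label (Psi_inj L1 (esym eb)).
rewrite !addrA ca cb -sz; have := slopeP t => s.
apply/eqP; rewrite -subr_eq0; apply/eqP.
transitivity ((1 + d) ^+ size u * ((a - b) - d * (tau i' - tau i))); first by ring.
by rewrite s subrr mulr0.
Qed.

Let pad m w : w ++ nseq m.+1 ord0 = rcons (w ++ nseq m ord0) ord0.
Proof. by rewrite rcons_cat -cats1; congr cat; elim: m => //= m <-. Qed.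

Let shift_pad m w :
  complex_shift L nu 0 (w ++ nseq m ord0) = complex_shift L nu 0 w.
Proof.
elim: m => [|m IH]; first by rewrite cats0.
by rewrite pad complex_shift_rcons IH nu0 /padd /pscale /= !mulr0 !addr0.
Qed.

Let label_pad m w : word_label (rev (w ++ nseq m ord0)) = word_label (rev w).
Proof.
elim: m => [|m IH]; first by rewrite cats0.
by rewrite pad rev_rcons /= IH subrr mulr0 addr0.
Qed.

Lemma label_complex w w' j j' :
  padd (P j) (complex_shift L nu 0 w) = padd (P j') (complex_shift L nu 0 w') ->
  j + word_label (rev w) = j' + word_label (rev w').
Proof.
(* Truncated subtraction: only the shorter address is really padded. *)
rewrite -(shift_pad (size w' - size w) w) -(shift_pad (size w - size w') w').
rewrite -(label_pad (size w' - size w) w) -(label_pad (size w - size w') w').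
set u := w ++ _; set u' := w' ++ _.
have sz : size u = size u' by rewrite !size_cat !size_nseq; lia.
rewrite !padd_complex_shift ?gt_eqF // sz => e; apply: label_PsiW.
  by rewrite !size_rev.
have Ls : L ^+ size u' != 0 by rewrite expf_neq0 // gt_eqF.
case: e => /(mulfI Ls) e1 /(mulfI Ls) e2.
by rewrite [LHS]surjective_pairing e1 e2 -surjective_pairing.
Qed.

(** * Rotations and the good labelling of order 0 *)

Variable v : 'I_n.+2 -> R * R.
Hypothesis v_inj : injective v.
Hypothesis v_range : V0 = range v.

(** The powers of zeta sum to zero. As [v] may list the vertices in another order, the sum is
    reindexed. *)
Lemma barycenterE : barycenterM L v 0 = c.
Proof.
have /choice[p vE] i : exists j, v i = P j.
  have : range v (v i) by exists i.
  by rewrite -v_range => -[j _ <-]; exists j.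
have p_inj : injective p by move=> i j e; apply: v_inj; rewrite !vE e.
have sum0 : \sum_(j < n.+2) zeta ^+ j = 0.
  have /eqP := subrX1 zeta n.+2; rewrite (prim_expr_order prz) subrr eq_sym.
  rewrite mulf_eq0 subr_eq0 => /orP[|/eqP //].
  by rewrite -{1}[zeta]expr1 -(prim_order_dvd prz).
apply: toC_inj; rewrite toC_pscale (toC_sum (fun j => pscale (L ^ 0) (v j))).
have -> : \sum_j toC (pscale (L ^ 0) (v j)) = \sum_j toC (P j).
  rewrite [RHS](reindex_inj p_inj); apply: eq_bigr => j _.
  by rewrite toC_pscale expr0z rmorph1 mul1r vE.
under eq_bigr do rewrite PE.
rewrite big_split /= -mulr_sumr sum0 mulr0 addr0 sumr_const card_ord.
rewrite -[toC c *+ _]mulr_natl mulrA fmorphV rmorph_nat mulVf ?mul1r //.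
Qed.

Lemma rotation_vertex (s j : 'I_n.+2) :
  rotation_about c (complex.Re (zeta ^+ s)) (complex.Im (zeta ^+ s)) (P j)
    = P (j + s).
Proof.
apply: toC_inj; rewrite toC_rotation_about !PE.
have -> : Complex (complex.Re (zeta ^+ s)) (complex.Im (zeta ^+ s)) = zeta ^+ s.
  by case: (zeta ^+ s).
rewrite /= (prim_expr_mod prz (j + s)%N) exprD; ring.
Qed.

Lemma exists_good_labelling : exists ell, good_labelling L nu V0 v 0 ell.
Proof.
(* A vertex may lie in several complexes, but [label_complex] makes its label independent of the
   choice; other points get 0. The empty word covers [V0] itself. *)
have /choice[ell ellP] (x : R * R) : exists l, forall j w,
    x = padd (P j) (complex_shift L nu 0 w) -> l = j + word_label (rev w).
  have [[j [w e]]|none] := EM (exists j w, x = padd (P j) (complex_shift L nu 0 w)).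
    exists (j + word_label (rev w)) => j' w' e'.
    by apply: label_complex; rewrite -e.
  by exists 0 => j w e; case: none; exists j, w.
have VE : VMM L V0 0 = V0.
  have id x : pscale (L ^ 0) x = x.
    by rewrite /pscale expr0z !mul1r -surjective_pairing.
  rewrite /VMM; apply/seteqP; split=> x; first by move=> [y Vy <-]; rewrite id.
  by move=> Vx; exists x; rewrite ?id.
have ell_P j : ell (P j) = j.
  rewrite (ellP (P j) j [::]) /= ?addr0 // complex_shift_nil /padd /= !addr0.
  exact: surjective_pairing.
exists ell; split=> [a|w _].
  exists (P a); rewrite VE; split=> [|x [[j _ <-]]]; first by split=> //; exists a.
  by rewrite ell_P => ->.
(* In this complex the labels are the vertex numbers plus [s], so its rotation is multiplication by
   [zeta ^+ s] about [c]. *)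
set s := word_label (rev w).
exists (rotation_about c (complex.Re (zeta ^+ s)) (complex.Im (zeta ^+ s))); split.
  exists (complex.Re (zeta ^+ s)), (complex.Im (zeta ^+ s)); split; [|split].
  - by rewrite -expiMn /= cos2Dsin2.
  - by rewrite barycenterE.
  rewrite VE; apply/seteqP; split=> x.
    by move=> [_ [j _ <-] <-]; rewrite rotation_vertex; exists (j + s).
  move=> [j _ <-]; exists (P (j - s)); first by exists (j - s).
  by rewrite rotation_vertex subrK.
move=> x [y]; rewrite VE => -[j _ <-] <-.
rewrite (_ : psub _ _ = P j); last first.
  by rewrite /psub /padd /= !addrK -surjective_pairing.
by rewrite rotation_vertex ell_P; exact: ellP.
Qed.
End Labelling.

(** * Reduction to homotheties centred at the polygon vertices *)

Theorem theorem3p13 (R : realType) (L : R) (N : nat) (nu : 'I_N -> (R * R)%type)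
  (K V0 : set (R * R)%type) (k : nat) (v : 'I_k -> (R * R)%type) :
  simple_nested_fractal L nu K V0 v ->
  (3 <= k)%N ->
  k = N ->
  good_labelling_property L nu V0 v.
Proof.
move=> [[L1 _ nu0] [cK K0 KE] [V0E v_inj v_range poly] _ [nest _ conn]] k3 kN.
(* In the form [n.+2], ['I_k] carries the ring structure of Z/k. *)
subst N; case: k => [|[|n]] // in v nu k3 V0E v_inj v_range poly nu0 KE nest conn *.
have [c [r [rho [P [VP rho0 PE Pr]]]]] := regular_polygonP (ltn0Sn _) poly.
have L0 : L != 0 by rewrite gt_eqF // (lt_trans ltr01).
have fixedE i x : Psi L nu i x = x -> nu i = pscale (1 - L^-1) x.
  move=> e; have := congr1 fst e; have := congr1 snd e; rewrite /= => e2 e1.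
  by rewrite [LHS]surjective_pairing; congr pair; lra.
have PsiK i : Psi L nu i @` K `<=` K.
  by move=> x Kx; rewrite KE; exists i.
have PV j : V0 (P j) by rewrite VP; exists j.
have /choice[sigma fixP] j : exists i, Psi L nu i (P j) = P j.
  by have := PV j; rewrite V0E => -[].
have P_inj : injective P.
  move=> i j /(congr1 (@toC R)); rewrite !PE => /addrI/(mulfI rho0)/eqP.
  by rewrite (eq_prim_root_expr (expi_prim R (ltn0Sn _))) !modn_small // => /eqP/val_inj.
have sigma_inj : injective sigma.
  move=> i j e; apply: P_inj.
  have := fixedE _ _ (fixP i); rewrite e (fixedE _ _ (fixP j)) => -[].
  have l0 : 1 - L^-1 != 0 by rewrite gt_eqF // subr_gt0 invf_lt1 // (lt_trans ltr01).
  move=> /(mulfI l0) e1 /(mulfI l0) e2.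
  by rewrite [LHS]surjective_pairing [RHS]surjective_pairing e1 e2.
(* Here k = N turns the injection from vertices to similitudes into a bijection. *)
have [tau sigmaK tauK] := injF_bij sigma_inj.
have V0K : range P `<=` K.
  move=> _ [j _ <-]; apply: (compact_fixed_point L1 cK K0 (PsiK (sigma j))).
  exact: fixP.
have nuE i : nu i = pscale (1 - L^-1) (P (tau i)).
  by apply: fixedE; have := fixP (tau i); rewrite tauK.
rewrite VP in nest conn v_range *.
have nesting i j : i <> j -> Psi L nu i @` K `&` Psi L nu j @` K `<=`
    Psi L nu i @` range P `&` Psi L nu j @` range P.
  move=> ij; have := nest 1%N [:: i] [:: j] erefl erefl.
  by move=> -> // -[].
have tau_bij : bijective tau by exists sigma.
have [d dP] := slope_exists L1 rho0 PE Pr nuE tau_bij V0K PsiK nesting conn.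
have [ell ellP] := exists_good_labelling L1 rho0 PE Pr nuE tau_bij V0K PsiK nesting
  (nu0 ord0 erefl) dP v_inj v_range.
by exists 0, ell.
Qed.
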